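(* Let $\nu\in\mathbb M$ be ergodic with respect to $\mathbb S\times\mathbb O$ and aperiodic. Then for every $k\ge0$ and all distinct $r_1,r_2\in\{0,\dots,2^k-1\}$, the measures $\mathcal P_{r_1,k}[\nu]$ and $\mathcal P_{r_2,k}[\nu]$ are mutually singular.
   Context: $I=\{0,1\}$. $\mathbb S$ is the left shift on $I^{\mathbb Z}$; $\mathbb S^j\eta$ denotes pushforward. $I^{\mathbb N}$ is the space of $0$–$1$ sequences $(\alpha_i)_{i\ge1}$ with uniform Bernoulli measure $m$; $\mathbb O$ is the odometer (if $\alpha_1=\dots=\alpha_{n-1}=1$, $\alpha_n=0$, then $\mathbb O[\alpha]_i=0$ for $i<n$, $\mathbb O[\alpha]_n=1$, $\mathbb O[\alpha]_i=\alpha_i$ for $i>n$). $\mathbb M$ is the set of Borel probability measures on $I^{\mathbb Z}\times I^{\mathbb N}$ invariant under $\mathbb S\times\mathbb O$. $A_{r,k}=\{\alpha:\sum_{i=1}^k\alpha_i2^{i-1}=r\}$; $\mathcal P_{r,k}[\nu]$ is the normalized projection to $I^{\mathbb Z}$ of $\nu$ restricted to $I^{\mathbb Z}\times A_{r,k}$. For $k\ge0$ and an $\mathbb S^{2^k}$-invariant Borel probability measure $\eta$ on $I^{\mathbb Z}$, $D_k[\eta]=\sum_{i=0}^{2^k-1}\mathbb S^i\eta\times(\chi_{A_{i,k}}m)$. A measure $\nu\in\mathbb M$ is of periodic type if $\nu=D_k[\eta]$ for some $k\ge0$ and some $\mathbb S^{2^k}$-invariant $\eta$; otherwise it is aperiodic.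 *)

(* Defs.v *)
From HB Require Import structures.
From mathcomp Require Import all_boot all_order all_algebra.
From mathcomp Require Import all_classical all_reals all_analysis.
Set Implicit Arguments. Unset Strict Implicit. Unset Printing Implicit Defensive.
Import Order.TTheory GRing.Theory Num.Theory.
Local Open Scope classical_set_scope.
Local Open Scope ring_scope.

(* I = {0,1} is bool (false = 0, true = 1). *)

(* Cylinder generators: the Borel sigma-algebra of the compact metrizable
   product space I^Z (resp. I^N) is the product sigma-algebra generated by the
   coordinate cylinders. *)
Definition cylZ : set (set (int -> bool)) :=
  [set A | exists (i : int) (b : bool), A = [set x | x i = b]].
Definition cylN : set (set (nat -> bool)) :=
  [set A | exists (i : nat) (b : bool), A = [set a | a i = b]].

Definition IZ := g_sigma_algebraType cylZ.
Definition IN := g_sigma_algebraType cylN.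
Definition IZN := (IZ * IN)%type.

Definition shift (x : IZ) : IZ := fun i => x (i + 1).

(* Odometer on I^N.  Coordinates are indexed from 0 (a i = alpha_{i+1}).
   Bit i flips iff all lower bits are 1 (adding 1 with carry);
   the all-ones sequence is sent to the all-zeros sequence. *)
Definition odometer (a : IN) : IN :=
  fun i => xorb (a i) [forall j : 'I_i, a j].

Definition SO (p : IZN) : IZN := (shift p.1, odometer p.2).

Definition Ark (r k : nat) : set IN :=
  [set a | (\sum_(i < k) (a i : nat) * 2 ^ i)%N = r].

Section Defs.
Context (R : realType).
Local Open Scope ereal_scope.

Definition invariant_SO (nu : set IZN -> \bar R) : Prop :=
  forall A : set IZN, measurable A -> nu (SO @^-1` A) = nu A.

Definition ergodic_SO (nu : set IZN -> \bar R) : Prop :=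
  forall A : set IZN, measurable A -> SO @^-1` A = A -> nu A = 0 \/ nu A = 1.

(* m is the uniform Bernoulli measure on I^N: every cylinder fixing the
   first n coordinates has measure 2^-n (this determines m uniquely). *)
Definition uniform_bernoulli (m : set IN -> \bar R) : Prop :=
  forall (n : nat) (w : nat -> bool),
    m [set a : IN | forall i, (i < n)%N -> a i = w i] = ((2%:R ^- n)%R)%:E.

Definition Dk (m : set IN -> \bar R) (k : nat) (eta : set IZ -> \bar R)
  : set IZN -> \bar R :=
  fun A => \sum_(i < 2 ^ k)
     ((pushforward eta (iter i shift)) \x (fun C => m (C `&` Ark i k))) A.

Definition periodic_type (m : set IN -> \bar R) (nu : set IZN -> \bar R) : Prop :=
  exists (k : nat) (eta : probability IZ R),
    (forall B : set IZ, measurable B -> eta (iter (2 ^ k) shift @^-1` B) = eta B)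
    /\ (forall A : set IZN, measurable A -> nu A = Dk m k eta A).

Definition aperiodic (m : set IN -> \bar R) (nu : set IZN -> \bar R) : Prop :=
  ~ periodic_type m nu.

Definition Pproj (nu : set IZN -> \bar R) (r k : nat) : set IZ -> \bar R :=
  fun B => ((fine (nu (B `*` Ark r k)) / fine (nu (setT `*` Ark r k)))%R)%:E.

Definition mutually_singular (mu1 mu2 : set IZ -> \bar R) : Prop :=
  exists B : set IZ, measurable B /\ mu1 B = 0 /\ mu2 (~` B) = 0.

End Defs.

(* Main.v *)
Require Import Defs.
From HB Require Import structures.
From mathcomp Require Import all_boot all_order all_algebra.
From mathcomp Require Import all_classical all_reals all_analysis.
From mathcomp Require Import ring lra zify.
Set Implicit Arguments. Unset Strict Implicit. Unset Printing Implicit Defensive.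
Import Order.TTheory GRing.Theory Num.Theory.
Local Open Scope classical_set_scope.
Local Open Scope ring_scope.

(** Let [strip n r] be the projection to [I^Z] of [nu] restricted to
    [I^Z x A_(r mod 2^n),n], an unnormalized [P_(r,n)[nu]].  The shift maps
    [strip n r] to [strip n (r + 1)], ergodicity of [nu] makes [strip n r] ergodic
    for the [2^n]-th power of the shift, and hence two strips of level [n] are equal
    or mutually singular.  Suppose [strip n a] = [strip n b] with [a], [b] distinct
    modulo [2^n].  Each side is a sum of two strips of level [n + 1], so these four
    strips cannot be pairwise singular; an equality among them forces
    [strip (n + 1) c] = [strip (n + 1) (c + 2^n)] for all [c], hence
    [strip n c] = 2 [strip (n + 1) c].  Iterating from [n = k], [nu] agrees on all
    rectangles over cylinders with [D_k] of the normalized [strip k 0], so it is of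
    periodic type. *)

(** * Hahn decompositions invariant under a charge-preserving map *)

Section InvariantHahn.
Context d (T : measurableType d) (R : realType).
Local Open Scope ereal_scope.
Local Open Scope charge_scope.
Implicit Types (nu : {charge set T -> \bar R}) (f : T -> T).

Lemma positive_set_copp nu P : (copp nu).-positive_set P <-> nu.-negative_set P.
Proof.
by split=> -[mP h]; split=> // A mA AP; have := h A mA AP; rewrite /copp/= oppe_ge0.
Qed.

Lemma negative_set_copp nu P : (copp nu).-negative_set P <-> nu.-positive_set P.
Proof.
by split=> -[mP h]; split=> // A mA AP; have := h A mA AP; rewrite /copp/= oppe_le0.
Qed.

Lemma hahn_decomposition_copp nu P N :
  hahn_decomposition nu P N -> hahn_decomposition (copp nu) N P.
Proof.
case=> pP nN PN PN0; split; [exact/positive_set_copp|exact/negative_set_copp| |].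
- by rewrite setUC.
- by rewrite setIC.
Qed.

Lemma hahn_decomposition_max nu P N A : hahn_decomposition nu P N ->
  measurable A -> nu A <= nu P.
Proof.
case=> -[mP pP] [mN nN] PN PN0 mA.
rewrite (charge_partition nu mA mP mN PN PN0) (chargeDI nu mP mA) addeC (setIC P).
apply: leeD2r; apply: (@le_trans _ _ 0).
  by apply: nN; [exact: measurableI|exact: subIsetr].
by apply: pP; [exact: measurableD|exact: subDsetl].
Qed.

(** The preimage of [P] has the same charge as [P], which is maximal; removing a subset [A] cannot
    raise the charge, so [nu A] is nonnegative. *)
Lemma positive_set_preimage nu P N f : hahn_decomposition nu P N ->
  measurable_fun setT f ->
  (forall A, measurable A -> nu (f @^-1` A) = nu A) ->
  nu.-positive_set (f @^-1` P).
Proof.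
move=> nuPN mf nuf; have [[mP _] _ _ _] := nuPN.
have mfP : measurable (f @^-1` P) by rewrite -[X in measurable X]setTI; exact: mf.
split=> // A mA AP.
have mD : measurable (f @^-1` P `\` A) by exact: measurableD.
have := hahn_decomposition_max nuPN mD.
rewrite -(nuf P)// (chargeDI nu mfP mA) (_ : _ `&` A = A); last exact/setIidPr.
move: (fin_num_measure nu _ mD) (fin_num_measure nu _ mA) => /fineK <- /fineK <-.
by rewrite -EFinD !lee_fin lerDl.
Qed.

Lemma measurable_fun_iter f n : measurable_fun setT f ->
  measurable_fun setT (iter n f).
Proof.
by move=> mf; elim: n => [|n IH]; [exact: measurable_id|exact: measurableT_comp].
Qed.

Lemma preimage_iter_invariant (mu : set T -> \bar R) f n :
  measurable_fun setT f ->
  (forall A, measurable A -> mu (f @^-1` A) = mu A) ->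
  forall A, measurable A -> mu (iter n f @^-1` A) = mu A.
Proof.
move=> mf muf; elim: n => // n IH A mA.
rewrite -[RHS]muf// -(IH (f @^-1` A))//.
by rewrite -[X in measurable X]setTI; exact: mf.
Qed.

(* The set of points visiting [P] infinitely often is strictly invariant, and it
   is still a positive set of a Hahn decomposition. *)
Lemma invariant_hahn_decomposition nu f : measurable_fun setT f ->
  (forall A, measurable A -> nu (f @^-1` A) = nu A) ->
  exists P N, hahn_decomposition nu P N /\ f @^-1` P = P.
Proof.
move=> mf nuf; have [P [N nuPN]] := Hahn_decomposition nu.
have [[mP _] [mN _] PN PN0] := nuPN.
pose Q := lim_sup_set (fun i => iter i f @^-1` P).
have mpre i A : measurable A -> measurable (iter i f @^-1` A).
  by move=> mA; rewrite -[X in measurable X]setTI; exact: (measurable_fun_iter i mf).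
have nufi i := preimage_iter_invariant i mf nuf.
have pPi i : nu.-positive_set (iter i f @^-1` P).
  exact: (positive_set_preimage nuPN (measurable_fun_iter i mf) (nufi i)).
have nNi i : nu.-negative_set (iter i f @^-1` N).
  (* Passing to the opposite charge exchanges the roles of [P] and [N]. *)
  apply/positive_set_copp; apply: (@positive_set_preimage (copp nu) N P).
  - exact: hahn_decomposition_copp.
  - exact: measurable_fun_iter.
  - by move=> A mA; congr (- _); exact: nufi.
have mQ : measurable Q.
  apply: bigcap_measurable => // k _.
  by apply: bigcup_measurable => i _; exact: mpre.
exists Q, (~` Q); split; last first.
  apply/seteqP; split=> x Qx n _.
    have [i /= ni Pi] := Qx n I; exists i.+1; first exact: leqW.
    by rewrite /preimage/= -iterS iterSr.
  (* A visit at a time at least [n.+1] happens at a successor [i.+1], hence is a visit of [f x] at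
     time [i]. *)
  have [[//|i] /= ni Pi] := Qx n.+1 I.
  by exists i => //; rewrite /preimage/= -iterSr.
split; [| |exact: setUv|exact: setICr].
(* [Q] lies in a countable union of positive sets, and its complement in a countable union of
   negative sets. *)
- have : (copp nu).-negative_set (\bigcup_i (iter i f @^-1` P)).
    by apply: bigcup_negative_set => i; exact/negative_set_copp.
  move=> /negative_set_copp[_ pU]; split=> // A mA AQ; apply: pU => //.
  by move=> x /AQ /(_ 0%N I)[i _ Pi]; exists i.
- have : nu.-negative_set (\bigcup_m \bigcap_(i >= m) (iter i f @^-1` N)).
    apply: bigcup_negative_set => m; have [_ nN] := nNi m; split.
      by apply: bigcap_measurable; [exists m => /=|move=> i _; exact: mpre].
    by move=> A mA AN; apply: nN => // x /AN /(_ m); apply => /=.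
  move=> [_ nU]; split; first exact: measurableC.
  move=> A mA AQ; apply: nU => // x /AQ; rewrite /Q /lim_sup_set.
  rewrite setC_bigcap => -[m _]; rewrite setC_bigcup => h; exists m => // i mi.
  have /= := h i mi; have : (P `|` N) (iter i f x) by rewrite PN.
  by case.
Qed.

(** An invariant Hahn set [P] of [mu1 - mu2] is null or conull for each measure. If it is null for
    one and conull for the other, they are singular. Otherwise both live on the same side, where one
    dominates the other, and equal total masses force equality. *)
Lemma ergodic_eq_or_singular (mu1 mu2 : {finite_measure set T -> \bar R}) f :
  measurable_fun setT f ->
  (forall A, measurable A -> mu1 (f @^-1` A) = mu1 A) ->
  (forall A, measurable A -> mu2 (f @^-1` A) = mu2 A) ->
  (forall A, measurable A -> f @^-1` A = A -> mu1 A = 0 \/ mu1 (~` A) = 0) ->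
  (forall A, measurable A -> f @^-1` A = A -> mu2 A = 0 \/ mu2 (~` A) = 0) ->
  mu1 setT = mu2 setT ->
  (forall A, measurable A -> mu1 A = mu2 A) \/
  (exists A, [/\ measurable A, mu1 A = 0 & mu2 (~` A) = 0]).
Proof.
move=> mf inv1 inv2 erg1 erg2 mass.
pose psi := cadd (charge_of_finite_measure mu1)
                 (copp (charge_of_finite_measure mu2)).
have psiE A : psi A = mu1 A - mu2 A by [].
have psif A : measurable A -> psi (f @^-1` A) = psi A.
  by move=> mA; rewrite !psiE inv1// inv2.
have [P [N [[[mP pP] [mN nN] PN PN0] fP]]] := invariant_hahn_decomposition mf psif.
have NE : N = ~` P.
  apply/seteqP; split=> x Nx.
    by move=> Px; have : (P `&` N) x by []; rewrite PN0.
  by have [] : (P `|` N) x by rewrite PN.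
subst N.
have fin1 := fin_num_measure mu1; have fin2 := fin_num_measure mu2.
have split_ (mu : {finite_measure set T -> \bar R}) A B : measurable A ->
    measurable B -> mu B = 0 -> mu A = mu (A `&` ~` B).
  move=> mA mB B0; rewrite -setDE (measureDI mu mA mB).
  by rewrite (subset_measure0 (measurableI _ _ mA mB) mB (@subIsetr _ _ _) B0) adde0.
(* Domination off the common null set [B] holds for [A] and for its complement; as the two sums
   agree, both inequalities are equalities. *)
have nullEq B : measurable B -> mu1 B = 0 -> mu2 B = 0 ->
    (forall A, measurable A -> mu1 (A `&` ~` B) <= mu2 (A `&` ~` B)) \/
    (forall A, measurable A -> mu2 (A `&` ~` B) <= mu1 (A `&` ~` B)) ->
    forall A, measurable A -> mu1 A = mu2 A.
  move=> mB B1 B2 h A mA; have mCA := measurableC mA.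
  have tot (mu : {finite_measure set T -> \bar R}) : mu setT = mu A + mu (~` A).
    by rewrite -(setUv A) measureU//; exact: setICr.
  move: mass; rewrite !tot.
  have : (mu1 A <= mu2 A /\ mu1 (~` A) <= mu2 (~` A)) \/
         (mu2 A <= mu1 A /\ mu2 (~` A) <= mu1 (~` A)).
    rewrite (split_ mu1 A B)// (split_ mu2 A B)//.
    rewrite (split_ mu1 (~` A) B)// (split_ mu2 (~` A) B)//.
    by case: h => h; [left|right]; split; exact: h.
  rewrite -(fineK (fin1 _ mA)) -(fineK (fin2 _ mA)).
  rewrite -(fineK (fin1 _ mCA)) -(fineK (fin2 _ mCA)) -!EFinD !lee_fin.
  move=> le_ [eq_]; congr (_%:E).
  by case: le_ => -[h1 h2]; lra.
have mCP := measurableC mP.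
have [P1|P1] := erg1 _ mP fP; have [P2|P2] := erg2 _ mP fP.
- left; apply: (nullEq P) => //; left=> A mA.
  have mI : measurable (A `&` ~` P) by exact: measurableI.
  have : psi (A `&` ~` P) <= 0 := nN _ mI (@subIsetr _ _ _).
  by rewrite psiE sube_le0.
- by right; exists P.
- by right; exists (~` P); split=> //; rewrite setCK.
- left; apply: (nullEq (~` P)) => //; right=> A mA; rewrite setCK.
  have mI : measurable (A `&` P) by exact: measurableI.
  have : 0 <= psi (A `&` P) := pP _ mI (@subIsetr _ _ _).
  by rewrite psiE sube_ge0// fin2.
Qed.

End InvariantHahn.

(** * Arithmetic modulo powers of two *)

Section ResiduesModuloPowersOfTwo.
Local Open Scope nat_scope.

Lemma modn_mul2 x p : 0 < p -> x %% (2 * p) = x %% p + odd (x %/ p) * p.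
Proof.
move=> p0; rewrite {1}(divn_eq x p) -{1}(odd_double_half (x %/ p)) -muln2.
rewrite mulnDl -mulnA (addnC (_ * p)) -addnA modnMDl modn_small 1?addnC//.
by have := ltn_pmod x p0; case: odd; lia.
Qed.

Lemma eqn_mod_split x r p : 0 < p ->
  (x == r %[mod p]) = (x == r %[mod 2 * p]) || (x == r + p %[mod 2 * p]).
Proof.
move=> p0; rewrite !modn_mul2// modnDr divnDr// divnn p0 addn1 oddS.
have := ltn_pmod x p0; have := ltn_pmod r p0.
by case: (odd (x %/ p)); case: (odd (r %/ p)) => /=; lia.
Qed.

(** If [2 ^ v] is the exact power of two in [d], then [v <= n], and multiplying [d] by [2 ^ (n - v)]
    gives an odd multiple of [2 ^ n]. *)
Lemma exists_muln_mod_pow2 n d : ~~ (2 ^ n.+1 %| d) ->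
  exists j u, j * d = 2 ^ n + u * 2 ^ n.+1.
Proof.
elim: n => [|n IH] nd.
  exists 1, d./2; rewrite mul1n expn0 expn1 -{1}(odd_double_half d) -muln2.
  by move: nd; rewrite expn1 dvdn2 negbK => ->.
have [/dvdnP[u du]|/IH[j [u ju]]] := boolP (2 ^ n.+1 %| d).
  exists 1, u./2; have ou : odd u.
    by move: nd; rewrite du expnS dvdn_pmul2r ?expn_gt0// dvdn2 negbK.
  by rewrite mul1n du -{1}(odd_double_half u) ou -muln2 mulnDl mul1n -mulnA -expnS.
by exists (2 * j), u; rewrite -mulnA ju mulnDr (mulnCA 2) -!expnS.
Qed.

(** [E] is a translation-invariant equivalence relation on residues, so its periods form a subgroup
    of the integers modulo [2 ^ n.+1]; every nontrivial subgroup contains [2 ^ n]. *)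
Lemma half_period (E : nat -> nat -> Prop) n :
  (forall r s, E r s -> E s r) ->
  (forall r s t, E r s -> E s t -> E r t) ->
  (forall r s, E r s -> E r.+1 s.+1) ->
  (forall r s, r = s %[mod 2 ^ n.+1] -> E r s) ->
  forall a b, E a b -> a <> b %[mod 2 ^ n.+1] -> forall c, E c (c + 2 ^ n).
Proof.
move=> Esym Etr ES Emod a b Eab ab c.
have Eadd t r s : E r s -> E (r + t) (s + t).
  by move=> Ers; elim: t => [|t IH]; rewrite ?addn0// !addnS; exact: ES.
pose p := 2 ^ n.+1; have p0 : 0 < p by rewrite expn_gt0.
(* This represents [b - a] modulo [p] without truncated subtraction. *)
pose d := b + (p - 1) * a.
have Ed e : E e (e + d).
  apply: (Etr _ (a + (e + (p - 1) * a))); last first.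
    by rewrite /d (addnCA e b); exact: Eadd.
  apply: Emod; rewrite (_ : a + _ = a * p + e) ?modnMDl//.
  by rewrite mulnBl mul1n; nia.
have nd : ~~ (p %| d).
  apply/negP => pd; apply: ab; apply/eqP; rewrite -/p eq_sym.
  rewrite -(eqn_modDr ((p - 1) * a)) -/d (_ : a + _ = a * p); last by nia.
  by rewrite modnMl; exact: pd.
have [j [u ju]] := exists_muln_mod_pow2 nd.
have Ejd i : E c (c + i * d).
  elim: i => [|i IH]; first by apply: Emod; rewrite mul0n addn0.
  by rewrite mulSnr addnA; exact: Etr IH (Ed _).
by apply: (Etr _ _ _ (Ejd j)); apply: Emod; rewrite ju addnA addnC modnMDl.
Qed.

End ResiduesModuloPowersOfTwo.

(** * Binary digits, residue classes and the odometer *)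

Section Odometer.
Local Open Scope nat_scope.
Implicit Type a : IN.

Definition adic n a : nat := \sum_(i < n) a i * 2 ^ i.

Lemma adicS n a : adic n.+1 a = adic n a + a n * 2 ^ n.
Proof. by rewrite /adic big_ord_recr. Qed.

Lemma adic_lt n a : adic n a < 2 ^ n.
Proof.
elim: n => [|n IH]; first by rewrite /adic big_ord0.
by rewrite adicS expnS; case: (a n); lia.
Qed.

Lemma adicS_mod n a : adic n.+1 a = adic n a %[mod 2 ^ n].
Proof. by rewrite adicS addnC modnMDl. Qed.

Lemma adic_inj n a b : adic n a = adic n b -> forall i, i < n -> a i = b i.
Proof.
elim: n => // n IH ab i; rewrite ltnS leq_eqVlt => /predU1P[->{i}|].
  move: ab (adic_lt n a) (adic_lt n b); rewrite !adicS.
  by case: (a n); case: (b n) => //; lia.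
apply: IH; have := adicS_mod n a; rewrite ab adicS_mod.
by rewrite !modn_small ?adic_lt.
Qed.

(* The flag [forall j : 'I_n, a j] is the carry out of the first [n] bits. *)
Lemma adic_odometer_carry n a :
  adic n (odometer a) + [forall j : 'I_n, a j] * 2 ^ n = adic n a + 1.
Proof.
elim: n => [|n IH].
  rewrite /adic !big_ord0 (_ : [forall j, _] = true)//.
  by apply/forallP => -[].
rewrite !adicS {2}/odometer.
have -> : [forall j : 'I_n.+1, a j] = [forall j : 'I_n, a j] && a n.
  apply/forallP/andP => [h|[/forallP h an] j].
    split; last exact: (h ord_max).
    by apply/forallP => j; exact: (h (widen_ord (leqnSn n) j)).
  have := ltn_ord j; rewrite ltnS leq_eqVlt => /predU1P[->//|jn].
  exact: (h (Ordinal jn)).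
move: IH; rewrite expnS; case: [forall j : 'I_n, a j]; case: (a n) => /=; lia.
Qed.

Lemma adic_odometer n a : adic n (odometer a) = (adic n a).+1 %[mod 2 ^ n].
Proof. by rewrite -(addn1 (adic n a)) -adic_odometer_carry addnC modnMDl. Qed.

(** Reducing the index makes the family cyclic, so that [r.+1] and [r + 2 ^ n] are always admissible
    indices. *)
Definition residue n r : set IN := Ark (r %% 2 ^ n) n.

Lemma residueP n r a : residue n r a <-> adic n a = r %[mod 2 ^ n].
Proof. by rewrite (modn_small (adic_lt n a)). Qed.

Lemma residue_mod n r s : r = s %[mod 2 ^ n] -> residue n r = residue n s.
Proof. by rewrite /residue => ->. Qed.

Lemma residue_Ark n r : r < 2 ^ n -> residue n r = Ark r n.
Proof. by move=> rn; rewrite /residue modn_small. Qed.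

Lemma odometer_residue n r : odometer @^-1` residue n r.+1 = residue n r.
Proof.
have succ x y p : (x.+1 == y.+1 %[mod p]) = (x == y %[mod p]).
  by rewrite -(addn1 x) -(addn1 y) eqn_modDr.
apply/seteqP; split=> a /=; rewrite !residueP adic_odometer => /eqP h; apply/eqP.
  by rewrite -succ.
by rewrite succ.
Qed.

Lemma residue_split n r :
  residue n r = residue n.+1 r `|` residue n.+1 (r + 2 ^ n).
Proof.
have p0 : 0 < 2 ^ n by rewrite expn_gt0.
apply/seteqP; split=> a.
  rewrite residueP -adicS_mod => /eqP; rewrite eqn_mod_split// -expnS.
  by case/orP=> /eqP; [left|right]; apply/residueP.
move=> h; apply/residueP; rewrite -adicS_mod; apply/eqP.
rewrite eqn_mod_split// -expnS.
by case: h => /residueP ->; rewrite eqxx ?orbT.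
Qed.

Lemma residue_disjoint n r s : r <> s %[mod 2 ^ n] ->
  residue n r `&` residue n s = set0.
Proof.
move=> rs; rewrite -subset0 => a [/residueP ar /residueP as_]; apply: rs.
by rewrite -ar.
Qed.

Lemma residue_sub n n' s : n <= n' -> residue n' s `<=` residue n s.
Proof.
move=> nn' a; have [e ->] : exists e, n' = n + e by exists (n' - n); lia.
move/residueP => as_; apply/residueP.
have dv : 2 ^ n %| 2 ^ (n + e) by rewrite dvdn_exp2l// leq_addr.
have := congr1 (modn^~ (2 ^ n)) as_; rewrite !modn_dvdm// => <-.
elim: {as_ dv}e => [|e IH]; first by rewrite addn0.
by rewrite IH addnS adicS expnD mulnCA (mulnC (2 ^ n)) (addnC (adic _ _)) modnMDl.
Qed.

Lemma residue_setI_eq n n' r s : n <= n' -> s = r %[mod 2 ^ n] ->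
  residue n r `&` residue n' s = residue n' s.
Proof.
by move=> nn' sr; apply/setIidPr; rewrite -(residue_mod sr); exact: residue_sub.
Qed.

Lemma residue_setI_neq n n' r s : n <= n' -> s <> r %[mod 2 ^ n] ->
  residue n r `&` residue n' s = set0.
Proof.
move=> nn' sr; rewrite -subset0 => a [ra /(residue_sub nn') sa].
by have /seteqP[h _] := residue_disjoint sr; exact: (h a).
Qed.

Lemma measurable_bit i b : measurable ([set a | a i = b] : set IN).
Proof. by apply: sub_sigma_algebra; exists i, b. Qed.

Lemma measurable_Ark r n : measurable (Ark r n).
Proof.
elim: n r => [|n IH] r.
  have [->|r0] := eqVneq r 0.
    rewrite (_ : Ark _ _ = setT)//; apply/seteqP; split=> // a _.
    by rewrite /Ark/= big_ord0.
  rewrite (_ : Ark _ _ = set0)// -subset0 => a.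
  by rewrite /Ark/= big_ord0 => /esym/eqP; rewrite (negbTE r0).
(* Split on the top bit. If it is 1, the lower bits sum to [r - 2 ^ n]; the test guards against
   truncated subtraction. *)
rewrite (_ : Ark r n.+1 = ([set a | a n = false] `&` Ark r n) `|`
  ([set a | a n = true] `&` (if 2 ^ n <= r then Ark (r - 2 ^ n) n else set0))).
  apply: measurableU; apply: measurableI; rewrite ?IH//; try exact: measurable_bit.
  by case: ifP.
apply/seteqP; split=> a; rewrite /Ark/= -!/(adic _ a) adicS.
  case: (a n) => ar; [right|left]; split=> //=; last by move: ar; lia.
  by case: ifPn => /=; move: ar; rewrite -/(adic n a); lia.
case=> -[->]; first by lia.
by case: ifPn => //=; rewrite -/(adic n a); lia.
Qed.

Lemma measurable_residue n r : measurable (residue n r).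
Proof. exact: measurable_Ark. Qed.

(** Links residue classes to the cylinders on which [uniform_bernoulli] prescribes the measure. *)
Lemma residue_cylinder n r a : residue n r a ->
  residue n r = [set b : IN | forall i, i < n -> b i = a i].
Proof.
move=> ra; apply/seteqP; split=> b /=.
  move=> rb; apply: adic_inj; exact: etrans rb (esym ra).
move=> ba; rewrite /residue /Ark/= -ra.
by apply: eq_bigr => i _; rewrite ba.
Qed.

End Odometer.

Local Notation shift := Defs.shift.

Lemma measurable_shift : measurable_fun setT shift.
Proof.
apply: (@measurability _ _ IZ IZ setT shift cylZ) => //.
move=> _ [_ [i [b ->]] <-]; rewrite setTI.
by apply: sub_sigma_algebra; exists (i + 1), b.
Qed.

(** * Strips: equality, singularity and refinement *)

Section Strips.
Context (R : realType) (nu : probability IZN R).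
Local Open Scope ereal_scope.

Definition strip n r (B : set IZ) : \bar R := nu (B `*` residue n r).

Let strip0 n r : strip n r set0 = 0.
Proof. by rewrite /strip set0X measure0. Qed.

Let strip_ge0 n r B : 0 <= strip n r B.
Proof. exact: measure_ge0. Qed.

Let strip_sigma_additive n r : semi_sigma_additive (strip n r).
Proof.
move=> F mF tF mUF; rewrite /strip setX_bigcupl.
apply: measure_semi_sigma_additive.
- by move=> i; apply: measurableX => //; exact: measurable_residue.
- apply/trivIsetP => i j _ _ ij; rewrite -setXI.
  by move/trivIsetP : tF => /(_ i j I I ij) ->; rewrite set0X.
- rewrite -setX_bigcupl; apply: measurableX => //; exact: measurable_residue.
Qed.

HB.instance Definition _ n r := isMeasure.Build _ _ _ (strip n r)
  (strip0 n r) (strip_ge0 n r) (@strip_sigma_additive n r).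

Let strip_fin n r : fin_num_fun (strip n r).
Proof.
move=> B mB; apply: fin_num_measure; apply: measurableX => //.
exact: measurable_residue.
Qed.

HB.instance Definition _ n r := Measure_isFinite.Build _ _ _ (strip n r)
  (@strip_fin n r).

Lemma strip_mod n r s : r = s %[mod 2 ^ n] -> strip n r = strip n s.
Proof. by move=> rs; rewrite /strip (residue_mod rs). Qed.

Lemma strip_split n r B : measurable B ->
  strip n r B = strip n.+1 r B + strip n.+1 (r + 2 ^ n) B.
Proof.
move=> mB; rewrite {1}/strip residue_split.
rewrite (_ : B `*` _ = (B `*` residue n.+1 r) `|` (B `*` residue n.+1 (r + 2 ^ n))); last first.
  by apply/seteqP; split=> -[x a] /=; rewrite /setX/=; tauto.
rewrite measureU//.
- by apply: measurableX => //; exact: measurable_residue.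
- by apply: measurableX => //; exact: measurable_residue.
- rewrite -setXI residue_disjoint ?setX0//.
  apply/eqP; rewrite -{1}(addn0 r) eqn_modDl mod0n modn_small.
    by rewrite eq_sym -lt0n expn_gt0.
  by rewrite ltn_exp2l.
Qed.

Hypothesis nu_inv : invariant_SO nu.

Lemma strip_shift n r B : measurable B ->
  strip n r (shift @^-1` B) = strip n r.+1 B.
Proof.
move=> mB; rewrite /strip -(@nu_inv (B `*` residue n r.+1)).
  congr (nu _); rewrite -[X in _ `*` X]odometer_residue.
  by apply/seteqP; split=> -[x a].
by apply: measurableX => //; exact: measurable_residue.
Qed.

Lemma strip_iter_shift n r t B : measurable B ->
  strip n r (iter t shift @^-1` B) = strip n (r + t) B.
Proof.
elim: t r B => [|t IH] r B mB; first by rewrite addn0.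
rewrite addnS -strip_shift// -IH//.
by rewrite -[X in measurable X]setTI; exact: measurable_shift.
Qed.

(** An iterate of the shift carries one half of a strip to the other, so both have the same mass and
    the mass halves at each level. *)
Lemma strip_setT n r : strip n r setT = (2%:R ^- n)%:E.
Proof.
elim: n r => [|n IH] r.
  rewrite /strip (_ : residue 0 r = setT) ?setXTT ?probability_setT ?expr0 ?invr1//.
  by apply/seteqP; split=> // a _; apply/residueP; rewrite !modn1.
have := strip_split n r measurableT; rewrite IH -strip_iter_shift// preimage_setT.
have := @strip_fin n.+1 r setT measurableT => /fineK <-.
rewrite -EFinD => -[h]; congr (_%:E).
have : (2%:R ^- n = 2%:R * 2%:R ^- n.+1 :> R)%R.
  by rewrite exprS invfM mulrA divff ?mul1r// pnatr_eq0.
by move: h; move: (2%:R ^- n)%R (2%:R ^- n.+1)%R => u v; lra.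
Qed.

Hypothesis nu_erg : ergodic_SO nu.

(** Ergodicity of [nu] is applied to the set [C] of points whose forward orbit under [SO] meets the
    rectangle of [B] and [residue n r]. Over [residue n r] itself, [C] reduces to [B]. *)
Lemma strip_ergodic n r B : measurable B -> iter (2 ^ n) shift @^-1` B = B ->
  strip n r B = 0 \/ strip n r (~` B) = 0.
Proof.
move=> mB fB.
have fBj j x : B (iter (j * 2 ^ n) shift x) <-> B x.
  elim: j => [|j IH]; first by rewrite mul0n.
  by rewrite mulSn iterD -IH -{2}fB.
pose C : set IZN := [set p | exists i, B (iter i shift p.1) /\
                              adic n p.2 + i = r %[mod 2 ^ n]]%N.
have SOC : SO @^-1` C = C.
  apply/seteqP; split=> -[x a] [i /= [Bi ai]].
    exists i.+1; rewrite /= -/(iter i.+1 shift x) iterSr; split=> //.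
    by rewrite addnS -addSn -modnDml -adic_odometer modnDml.
  (* The hitting time may be 0 and cannot simply be decreased; a full period [2 ^ n], harmless for
     [B], is added first. *)
  exists (i + (2 ^ n).-1)%N; rewrite /= -iterSr -addnS prednK ?expn_gt0//.
  split.
    by rewrite addnC iterD; have := (fBj 1%N (iter i shift x)).2 Bi; rewrite mul1n.
  rewrite -modnDml adic_odometer modnDml addSnnS -addnS prednK ?expn_gt0//.
  by rewrite addnA modnDr.
have mC : measurable C.
  (* The congruence is solved for [adic n a], with [(2 ^ n).-1] playing the role of -1. *)
  rewrite (_ : C = \bigcup_i ((iter i shift @^-1` B) `*`
                              residue n (r + (2 ^ n).-1 * i))).
    apply: bigcupT_measurable => i; apply: measurableX.
      rewrite -[X in measurable X]setTI.
      exact: (measurable_fun_iter i measurable_shift).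
    exact: measurable_residue.
  have aE a i : (adic n a + i = r %[mod 2 ^ n] <->
                 adic n a = r + (2 ^ n).-1 * i %[mod 2 ^ n])%N.
    have e : ((2 ^ n).-1 * i + i = i * 2 ^ n)%N by rewrite -mulSnr prednK ?expn_gt0 1?mulnC.
    split=> /eqP h; apply/eqP.
      by rewrite -(eqn_modDr i) -addnA e (addnC r) modnMDl.
    by move: h; rewrite -(eqn_modDr i) -addnA e (addnC r) modnMDl.
  apply/seteqP; split=> -[x a].
    by move=> [i [/= Bi ai]]; exists i => //; split=> //; apply/residueP/aE.
  by move=> [i _ [/= Bi /residueP/aE ai]]; exists i.
have mBr (A : set IZ) : measurable A -> measurable (A `*` residue n r).
  by move=> mA; apply: measurableX => //; exact: measurable_residue.
have [C0|C1] := nu_erg mC SOC; [left|right].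
  apply: (subset_measure0 (mBr _ mB) mC _ C0).
  by move=> [x a] [/= Bx /residueP ar]; exists 0%N; rewrite addn0.
have C0 : nu (~` C) = 0 by rewrite probability_setC// C1 subee.
apply: (subset_measure0 (mBr _ (measurableC mB)) (measurableC mC) _ C0).
move=> [x a] [/= nBx /residueP ar] [i [/= Bi ai]]; apply: nBx.
(* Return times to a residue class of level [n] are multiples of [2 ^ n]. *)
have /dvdnP[j ij] : (2 ^ n %| i)%N.
  have : (i == 0 %[mod 2 ^ n])%N by rewrite -(eqn_modDl (adic n a)) addn0 ai ar.
  by rewrite mod0n.
by move: Bi; rewrite ij fBj.
Qed.

Definition eq_strip n r s := forall B, measurable B -> strip n r B = strip n s B.

Lemma eq_strip_or_singular n r s : eq_strip n r s \/
  exists B, [/\ measurable B, strip n r B = 0 & strip n s (~` B) = 0].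
Proof.
have inv t B : measurable B -> strip n t (iter (2 ^ n) shift @^-1` B) = strip n t B.
  by move=> mB; rewrite strip_iter_shift// (@strip_mod n (t + 2 ^ n) t)// modnDr.
apply: (@ergodic_eq_or_singular _ _ R (strip n r) (strip n s) (iter (2 ^ n) shift)).
- exact: measurable_fun_iter measurable_shift.
- exact: inv.
- exact: inv.
- by move=> A mA fA; exact: strip_ergodic.
- by move=> A mA fA; exact: strip_ergodic.
- exact: etrans (strip_setT n r) (esym (strip_setT n s)).
Qed.

Lemma eq_strip_half n : (forall a b, eq_strip n.+1 a b ->
  a <> b %[mod 2 ^ n.+1] -> forall c, eq_strip n.+1 c (c + 2 ^ n))%N.
Proof.
apply: half_period.
- by move=> r s h B mB; rewrite h.
- by move=> r s t h1 h2 B mB; rewrite h1// h2.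
- move=> r s h B mB; rewrite -!strip_shift// h//.
  by rewrite -[X in measurable X]setTI; exact: measurable_shift.
- by move=> r s /strip_mod rs B _; rewrite rs.
Qed.

(* If the four strips at level [n.+1] lying over [a] and [b] were pairwise
   singular, the two averages [strip n a] and [strip n b] could not coincide. *)
Lemma eq_strip_refine n a b : eq_strip n a b -> a <> b %[mod 2 ^ n] ->
  forall c, eq_strip n.+1 c (c + 2 ^ n).
Proof.
move=> eab ab.
(* A lift [c] of [b] stays distinct from [a] modulo [2 ^ n.+1], so one equality of strips
   suffices. *)
have refine c : c = b %[mod 2 ^ n] -> eq_strip n.+1 a c ->
    forall d, eq_strip n.+1 d (d + 2 ^ n).
  move=> cb eac; apply: (eq_strip_half eac) => ac; apply: ab; rewrite -cb.
  have dv : (2 ^ n %| 2 ^ n.+1)%N by rewrite dvdn_exp2l.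
  by rewrite -(modn_dvdm a dv) ac modn_dvdm.
have [/refine|[B1 [mB1 aB1 bB1]]] := eq_strip_or_singular n.+1 a b; first exact.
have [/refine|[B2 [mB2 aB2 bB2]]] := eq_strip_or_singular n.+1 a (b + 2 ^ n).
  by apply; rewrite modnDr.
(* [B] is null for strip [a] of level [n.+1], its complement for both halves of strip [b], hence for
   strip [a] of level [n]. So strip [a] of level [n.+1] would have mass zero. *)
pose B := B1 `|` B2; have mB : measurable B by exact: measurableU.
have mCB := measurableC mB.
have aB : strip n.+1 a B = 0.
  exact: (null_set_setU mB1 mB2 aB1 aB2).
have bCB : strip n b (~` B) = 0.
  rewrite strip_split// (subset_measure0 mCB (measurableC mB1) _ bB1).
    rewrite add0e (subset_measure0 mCB (measurableC mB2) _ bB2)//.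
    by apply: subsetC; exact: subsetUr.
  by apply: subsetC; exact: subsetUl.
have aCB : strip n.+1 a (~` B) = 0.
  have := bCB; rewrite -eab// strip_split// => /eqP.
  by rewrite padde_eq0 ?strip_ge0// => /andP[/eqP].
have : strip n.+1 a setT = 0.
  rewrite -(setUv B); exact: (null_set_setU mB mCB aB aCB).
rewrite strip_setT => -[] /eqP; rewrite invr_eq0 expf_eq0 /=.
by rewrite pnatr_eq0.
Qed.

Lemma strip_scale k a b : eq_strip k a b -> a <> b %[mod 2 ^ k] ->
  forall j c B, measurable B ->
    strip k c B = (2%:R ^+ j)%:E * strip (k + j) c B.
Proof.
move=> eab ab.
have half j c : eq_strip (k + j).+1 c (c + 2 ^ (k + j)).
  elim: j c => [|j IH] c; first by rewrite addn0; exact: eq_strip_refine eab ab c.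
  (* The pair 0 and [2 ^ (k + j)], distinct modulo [2 ^ (k + j).+1], carries the equality up one
     level. *)
  rewrite addnS; apply: (eq_strip_refine (IH 0%N)) => /eqP.
  rewrite mod0n add0n modn_small ?ltn_exp2l//.
  by rewrite eq_sym -[_ == _]negbK -lt0n expn_gt0.
elim=> [|j IH] c B mB; first by rewrite addn0 expr0 mul1e.
rewrite IH// strip_split// -half// addnS exprS.
have := strip_fin (k + j).+1 c mB => /fineK <-.
by rewrite -EFinD -!EFinM; congr (_%:E); lra.
Qed.

End Strips.

(** * Pushforward measures *)

Section MeasurePushforward.
Context d d' (T : measurableType d) (T' : measurableType d') (R : realType).
Variables (mu : {measure set T -> \bar R}) (f : T -> T').
Local Open Scope ereal_scope.

(** The argument [mf] carries the proof on which the measure structure declared below depends. *)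
Definition mpushforward (mf : measurable_fun setT f) : set T' -> \bar R :=
  pushforward mu f.

Variable mf : measurable_fun setT f.

Let mpushforward0 : mpushforward mf set0 = 0.
Proof. exact: measure0. Qed.

Let mpushforward_ge0 A : 0 <= mpushforward mf A.
Proof. exact: measure_ge0. Qed.

Let mpushforward_sigma_additive : semi_sigma_additive (mpushforward mf).
Proof. exact: measure_semi_sigma_additive. Qed.

HB.instance Definition _ := isMeasure.Build _ _ _ (mpushforward mf)
  mpushforward0 mpushforward_ge0 mpushforward_sigma_additive.

End MeasurePushforward.

Lemma measurable_iter_shift i : measurable_fun setT (iter i shift).
Proof. exact: measurable_fun_iter measurable_shift. Qed.

(** * A generating pi-system of rectangles *)

Section ResidueRectangles.
Variable k : nat.

Definition residue_rectangles : set (set IZN) :=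
  [set D | exists (B : set IZ) (C : set IN), [/\ measurable B,
     C = set0 \/ (exists n r, (k <= n)%N /\ C = residue n r) & D = B `*` C]].

Lemma residue_rectangle B n r : measurable B -> (k <= n)%N ->
  residue_rectangles (B `*` residue n r).
Proof. by move=> mB kn; exists B, (residue n r); split=> //; right; exists n, r. Qed.

Lemma bigcup_residue n : \bigcup_r residue n r = setT.
Proof. by apply/seteqP; split=> // a _; exists (adic n a) => //; apply/residueP. Qed.

(** Two residue classes are either nested or disjoint. *)
Lemma setI_closed_residue_rectangles : setI_closed residue_rectangles.
Proof.
move=> _ _ [B1 [C1 [mB1 hC1 ->]]] [B2 [C2 [mB2 hC2 ->]]]; rewrite -setXI.
exists (B1 `&` B2), (C1 `&` C2); split=> //; first exact: measurableI.
case: hC1 => [->|[n1 [r1 [kn1 ->]]]]; first by rewrite set0I; left.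
case: hC2 => [->|[n2 [r2 [kn2 ->]]]]; first by rewrite setI0; left.
wlog n12 : n1 n2 r1 r2 kn1 kn2 / (n1 <= n2)%N => [wh|].
  have [n12|/ltnW n21] := leqP n1 n2; first exact: wh.
  by rewrite setIC; exact: wh.
have [h|h] := pselect (r2 = r1 %[mod 2 ^ n1])%N.
  by rewrite residue_setI_eq//; right; exists n2, r2.
by rewrite residue_setI_neq//; left.
Qed.

(** Both coordinate projections are measurable for the generated sigma-algebra. *)
Lemma measurable_residue_rectangles :
  @measurable _ IZN = <<s residue_rectangles >>.
Proof.
pose T' := g_sigma_algebraType residue_rectangles.
have mfst : measurable_fun [set: T'] (fst : T' -> IZ).
  move=> _ A mA; rewrite setTI.
  rewrite (_ : _ @^-1` A = \bigcup_r (A `*` residue k r)); last first.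
    by rewrite -setX_bigcupr bigcup_residue setXT.
  apply: bigcupT_measurable => r; apply: sub_sigma_algebra.
  exact: residue_rectangle.
have msnd : measurable_fun [set: T'] (snd : T' -> IN).
  apply: (@measurability _ _ T' IN setT snd cylN) => //.
  move=> _ [_ [i [b ->]] <-]; rewrite setTI.
  (* Bit [i] is determined by the first [i.+1] digits; adding [k] keeps the level admissible. *)
  pose n := (k + i.+1)%N; pose D := [set r | residue n r `<=` [set a | a i = b]].
  rewrite (_ : _ @^-1` _ = \bigcup_(r in D) (setT `*` residue n r)).
    apply: bigcup_measurable => r _; apply: sub_sigma_algebra.
    by apply: residue_rectangle => //; rewrite /n leq_addr.
  rewrite -setX_bigcupr setTX; congr (_ @^-1` _); apply/seteqP; split=> a /=.
    move=> ai; have ra : residue n (adic n a) a by apply/residueP.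
    exists (adic n a) => //; rewrite /D/= (residue_cylinder ra) => a' /= ->//.
    by rewrite /n addnS ltnS leq_addl.
  by move=> [r]; exact.
rewrite eqEsubset; split.
  rewrite measurable_prod_measurableType; apply: smallest_sub.
    exact: smallest_sigma_algebra.
  move=> _ [A mA [B mB <-]].
  rewrite (_ : A `*` B = (setT `&` (fst @^-1` A)) `&` (setT `&` (snd @^-1` B))).
    by apply: (@measurableI _ T'); [exact: mfst|exact: msnd].
  by apply/seteqP; split=> -[x a] /=; rewrite /setX/=; tauto.
apply: smallest_sub; first exact: sigma_algebra_measurable.
move=> _ [B [C [mB hC ->]]]; apply: measurableX => //.
by case: hC => [->//|[n [r [_ ->]]]]; exact: measurable_residue.
Qed.

End ResidueRectangles.

(** * Equal strips force periodic type *)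

Section PeriodicType.
Context (R : realType) (m : probability IN R).
Local Open Scope ereal_scope.

Section Dk_measure.
Variables (eta : probability IZ R) (k : nat).

(** Convertible with [Dk], but assembled from constructions that make it a measure. *)
Definition Dk_measure : {measure set IZN -> \bar R} :=
  msum (fun i => mpushforward eta (@measurable_iter_shift i) \x mrestr m (measurable_Ark i k)) (2 ^ k).

Lemma Dk_measureE A : Dk_measure A = Dk m k eta A.
Proof. by []. Qed.

Lemma Dk_measureX B C : measurable B -> measurable C -> Dk_measure (B `*` C) =
  \sum_(i < 2 ^ k) eta (iter i shift @^-1` B) * m (Ark i k `&` C).
Proof.
move=> mB mC; apply: eq_bigr => i _.
rewrite setIC; exact: (product_measure1E (mpushforward eta (@measurable_iter_shift i))
  (mrestr m (measurable_Ark i k)) mB mC).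
Qed.

End Dk_measure.

Hypothesis hm : uniform_bernoulli m.
Variable nu : probability IZN R.
Hypotheses (nu_inv : invariant_SO nu) (nu_erg : ergodic_SO nu).

(** An empty class would give a strip of mass zero, against [strip_setT]; a point of the class
    exhibits it as a cylinder. *)
Lemma uniform_bernoulli_residue n r : m (residue n r) = (2%:R ^- n)%:E.
Proof.
have [ra0|/set0P[a ra]] := eqVneq (residue n r) set0.
  have := strip_setT nu_inv n r; rewrite /strip ra0 setX0 measure0 => -[] /esym/eqP.
  by rewrite invr_eq0 expf_eq0/= pnatr_eq0 andbF.
by rewrite (residue_cylinder ra) hm.
Qed.

Lemma eq_strip_periodic_type k a b : eq_strip nu k a b ->
  a <> b %[mod 2 ^ k] -> periodic_type m nu.
Proof.
(* The Dirac measure is only the default for mass zero or infinity; the mass here is [2 ^- k]. *)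
move=> eab ab; pose eta : probability IZ R := mnormalize (strip nu k 0) (dirac point).
have etaE B : eta B = strip nu k 0 B * (2%:R ^+ k)%:E.
  have massE : strip nu k 0 [set: g_sigma_algebraType cylZ] = (2%:R ^- k)%:E.
    exact: strip_setT.
  rewrite /eta/= /mnormalize/= massE ifF/= ?invrK//.
  by rewrite orbF eqe invr_eq0 expf_eq0/= pnatr_eq0 andbF.
have eta_iter t B : measurable B ->
    eta (iter t shift @^-1` B) = strip nu k t B * (2%:R ^+ k)%:E.
  by move=> mB; rewrite etaE strip_iter_shift.
exists k, eta; split=> [B mB|A mA].
  by rewrite eta_iter// etaE (@strip_mod _ nu k (2 ^ k) 0)// modnn mod0n.
rewrite -Dk_measureE.
apply: (measure_unique (residue_rectangles k) (fun r => setT `*` residue k r)) => //.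
- exact: measurable_residue_rectangles.
- exact: setI_closed_residue_rectangles.
- by move=> r; exact: residue_rectangle.
- by rewrite -setX_bigcupr bigcup_residue setXTT.
- move=> _ [B [C [mB [->|[n [r [kn ->]]]] ->]]]; first by rewrite setX0 !measure0.
  have [j ->{n kn}] : exists j, n = (k + j)%N by exists (n - k)%N; lia.
  have rk : (r %% 2 ^ k < 2 ^ k)%N by rewrite ltn_mod expn_gt0.
  rewrite Dk_measureX//; last exact: measurable_residue.
  (* Only the summand [r %% 2 ^ k] meets the class. It equals [2 ^ k * 2 ^- (k + j)] times
     [strip nu k r B], which is [strip nu (k + j) r B] by [strip_scale]. *)
  rewrite (bigD1 (Ordinal rk))//= big1 ?adde0; last first.
    move=> i ir; rewrite -residue_Ark// residue_setI_neq ?measure0 ?mule0//.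
      exact: leq_addr.
    move=> e; move/eqP: ir; apply; apply: val_inj => /=.
    by rewrite e modn_small.
  rewrite -[Ark _ _]/(residue k r) residue_setI_eq// ?leq_addr//.
  rewrite uniform_bernoulli_residue eta_iter// (@strip_mod _ nu k _ r) ?modn_mod//.
  rewrite (strip_scale nu_inv nu_erg eab ab j)// -[nu _]/(strip nu (k + j) r B).
  have := fin_num_measure (strip nu (k + j) r) B mB => /fineK <-.
  rewrite -!EFinM; congr (_%:E); rewrite exprD; field.
  by rewrite !expf_neq0 ?pnatr_eq0.
- move=> r; rewrite ltey_eq fin_num_measure//.
  by apply: measurableX => //; exact: measurable_residue.
Qed.

End PeriodicType.

Theorem theorem3 (R : realType) (m : probability IN R)
  (hm : uniform_bernoulli m) (nu : probability IZN R) :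
  invariant_SO nu -> ergodic_SO nu -> aperiodic m nu ->
  forall (k r1 r2 : nat), (r1 < 2 ^ k)%N -> (r2 < 2 ^ k)%N -> r1 <> r2 ->
  mutually_singular (Pproj nu r1 k) (Pproj nu r2 k).
Proof.
move=> nu_inv nu_erg nu_ap k r1 r2 r1k r2k r12.
have [eq12|[B [mB B1 B2]]] := eq_strip_or_singular nu_inv nu_erg k r1 r2.
  case: nu_ap; apply: (eq_strip_periodic_type hm nu_inv nu_erg eq12).
  by rewrite !modn_small.
(* Normalization divides by a constant, so null sets of a strip stay null. *)
have Pproj0 r A : (r < 2 ^ k)%N -> strip nu k r A = 0%E -> Pproj nu r k A = 0%E.
  by move=> rk; rewrite /strip residue_Ark// /Pproj => ->; rewrite mul0r.
by exists B; split=> //; split; exact: Pproj0.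
Qed.
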